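(* Let $P_1$ and $P_2$ be lower-L-bounded posets with $\hat 0$. Let $d(P_2)$ be the dual of $P_2$. Then the poset $P$ obtained by identifying the $\hat 0$ of $P_1$ with the $\hat 1$ of $d(P_2)$ satisfies $\pi(P)=e(P)$; that is, the limit $\pi(P)=\lim_{n\to\infty}\mathrm{La}(n,P)/\binom{n}{\lfloor n/2\rfloor}$ exists and equals $e(P)$.
   Context: All posets are finite and nonempty. Let $[n]=\{1,\dots,n\}$; families of subsets of $[n]$ are ordered by inclusion. A poset $(P,\le)$ contains a poset $(P',\le')$ as a (weak) subposet if there is an injection $f:P'\to P$ such that $u\le' v$ implies $f(u)\le f(v)$. A family $\mathcal F\subseteq 2^{[n]}$ is $P$-free if it does not contain $P$ in this sense. $\mathrm{La}(n,P)$ is the largest size of a $P$-free family $\mathcal F\subseteq 2^{[n]}$. $e(P)$ is the maximum integer $k\ge 0$ such that for all integers $n$ and $s$ the family $\binom{[n]}{s}\cup\binom{[n]}{s+1}\cup\cdots\cup\binom{[n]}{s+k-1}$ is $P$-free, where $\binom{[n]}{j}$ is the collection of $j$-element subsets of $[n]$ (empty if $j<0$ or $j>n$). The Lubell function of $\mathcal F\subseteq 2^{[n]}$ is the average over all $n!$ full (maximal) chains $\mathcal C$ of $2^{[n]}$ of $|\mathcal F\cap\mathcal C|$; equivalently $\bar h_n(\mathcal F)=\sum_{F\in\mathcal F}1/\binom{n}{|F|}$. $P$ is lower-L-bounded if for any $\beta\in(\frac12,1)$ and $\varepsilon>0$ there exists $N=N(\beta,\varepsilon)$ such that for all $n\ge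 N$, $\bar h_n(\mathcal F)\le e(P)+\varepsilon$ for all $P$-free families $\mathcal F$ of subsets of $[n]$ of sizes less than $\beta n$. An element $x$ of a poset $P$ is $\hat 0$ (resp. $\hat 1$) if $x\le p$ (resp. $x\ge p$) for all $p\in P$. The dual $d(P)$ of $P$ is the same set with the order reversed; the $\hat 0$ of $P_2$ is the $\hat 1$ of $d(P_2)$. The poset obtained by the identification is the disjoint union of $P_1$ and $d(P_2)$ with the two elements identified, ordered by the transitive closure of the union of the two orders (so every element of $d(P_2)$ lies below every element of $P_1$). *)

(* Defs.v *)
From HB Require Import structures.
From mathcomp Require Import all_boot all_order all_fingroup all_algebra.
From mathcomp Require Import all_classical all_reals all_analysis.

Set Implicit Arguments.
Unset Strict Implicit.
Unset Printing Implicit Defensive.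

Import Order.TTheory GRing.Theory Num.Theory.
Import numFieldNormedType.Exports.

Local Open Scope ring_scope.

(* The ground set [n] is represented by 'I_n, and 2^[n] by {set 'I_n}. *)

(* F contains P as a weak subposet: the order of P is preserved, but need not
   be reflected. *)
Definition contains_poset n (F : {set {set 'I_n}}) d (P : finPOrderType d) :
    bool :=
  [exists f : {ffun P -> {set 'I_n}},
    [&& injectiveb f, [forall x, f x \in F] &
        [forall x, forall y, (x <= y)%O ==> (f x \subset f y)]]].

Definition poset_free d (P : finPOrderType d) n (F : {set {set 'I_n}}) : bool :=
  ~~ contains_poset F P.

Definition La n d (P : finPOrderType d) : nat :=
  (\max_(F : {set {set 'I_n}} | poset_free P F) #|F|)%N.

Definition levels n (s : int) (k : nat) : {set {set 'I_n}} :=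
  [set A : {set 'I_n} | (s <= #|A|%:Z) && (#|A|%:Z < s + k%:Z)].

Definition levels_free d (P : finPOrderType d) (k : nat) : Prop :=
  forall (n : nat) (s : int), poset_free P (levels n s k).

(* The default value 0 is only relevant for the empty poset; see e_poset_max. *)
Definition e_poset d (P : finPOrderType d) : nat :=
  xget 0%N [set k : nat | levels_free P k /\
                          forall j : nat, levels_free P j -> (j <= k)%N]%classic.

Definition is_chain n (C : {set {set 'I_n}}) : bool :=
  [forall A in C, forall B in C, (A \subset B) || (B \subset A)].

Definition full_chains n : {set {set {set 'I_n}}} :=
  [set C : {set {set 'I_n}} | maxset (@is_chain n) C].

Definition lubell (R : realType) n (F : {set {set 'I_n}}) : R :=
  (\sum_(C in full_chains n) #|F :&: C|)%N%:R / #|full_chains n|%:R.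

Definition lower_L_bounded (R : realType) d (P : finPOrderType d) : Prop :=
  forall beta eps : R, 2^-1 < beta < 1 -> 0 < eps ->
  exists N : nat, forall n : nat, (N <= n)%N ->
  forall F : {set {set 'I_n}}, poset_free P F ->
    (forall A, A \in F -> #|A|%:R < beta * n%:R) ->
    lubell R F <= (e_poset P)%:R + eps.

(* The poset obtained from P and Q by identifying the bottom of P with the top
   of Q. The identified element is represented by inl \bot. *)
Definition glue_poset d1 d2 (P : finBPOrderType d1) (Q : finTPOrderType d2) : Type :=
  (P + {y : Q | y != \top%O})%type.

HB.instance Definition _ d1 d2 (P : finBPOrderType d1)
    (Q : finTPOrderType d2) :=
  Finite.copy (glue_poset P Q) (P + {y : Q | y != \top%O})%type.

Definition glue_inl d1 d2 (P : finBPOrderType d1) (Q : finTPOrderType d2)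
  (x : P) : glue_poset P Q := inl x.

Definition glue_inr d1 d2 (P : finBPOrderType d1) (Q : finTPOrderType d2)
    (y : Q) : glue_poset P Q :=
  if insub y is Some u then inr u else inl \bot%O.

Definition glue_base d1 d2 (P : finBPOrderType d1) (Q : finTPOrderType d2) :
    rel (glue_poset P Q) :=
  fun u v =>
    [exists x : P, exists x' : P,
      [&& u == glue_inl Q x, v == glue_inl Q x' & (x <= x')%O]] ||
    [exists y : Q, exists y' : Q,
      [&& u == glue_inr P y, v == glue_inr P y' & (y <= y')%O]].

(* connect is the reflexive transitive closure. *)
Definition glue_le d1 d2 (P : finBPOrderType d1) (Q : finTPOrderType d2) :
    rel (glue_poset P Q) :=
  connect (@glue_base _ _ P Q).

Lemma glue_leE d1 d2 (P : finBPOrderType d1) (Q : finTPOrderType d2)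
    (u v : glue_poset P Q) :
  glue_le u v = match u, v with
                | inl x, inl x' => (x <= x')%O
                | inl _, inr _ => false
                | inr _, inl _ => true
                | inr y, inr y' => (val y <= val y')%O
                end.
Proof.
set r : rel (glue_poset P Q) := fun u v => match u, v with
                | inl x, inl x' => (x <= x')%O
                | inl _, inr _ => false
                | inr _, inl _ => true
                | inr y, inr y' => (val y <= val y')%O
                end.
change (glue_le u v = r u v).
have rT : transitive r.
  by move=> [y|y] [x|x] [z|z] //=; apply: le_trans.
have rR : reflexive r by move=> [x|x] /=; apply: lexx.
have baser a b : glue_base a b -> r a b.
  case/orP => /existsP[x /existsP[x' /and3P[/eqP-> /eqP-> lexx']]] //.
  rewrite /glue_inr; case: insubP => [w xT wE|]; case: insubP => [w' x'T w'E|].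
  - by rewrite /= wE w'E.
  - by [].
  - rewrite negbK => /eqP xT.
    by case/eqP: x'T; apply/eqP; rewrite eq_le lex1 -xT.
  - by move=> _ _; apply: lexx.
apply/idP/idP.
  case/connectP => p pP ->; elim: p u pP => [|w p IH] u /=; first by rewrite rR.
  by case/andP => /baser ruw /IH; apply: rT.
have inrE (y : {y : Q | y != \top%O}) : inr y = glue_inr P (val y).
  by rewrite /glue_inr valK.
have topE : inl \bot%O = glue_inr P (\top%O : Q).
  by rewrite /glue_inr insubF ?eqxx.
have inl_base (x x' : P) : (x <= x')%O -> glue_le (glue_inl Q x) (glue_inl Q x').
  move=> le; apply: connect1; apply/orP; left.
  by apply/existsP; exists x; apply/existsP; exists x'; rewrite !eqxx.
have inr_base (y y' : Q) : (y <= y')%O -> glue_le (glue_inr P y) (glue_inr P y').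
  move=> le; apply: connect1; apply/orP; right.
  by apply/existsP; exists y; apply/existsP; exists y'; rewrite !eqxx.
case: u v => [x|y] [x'|y'] //=.
- exact: inl_base.
- move=> _; apply: (@connect_trans _ _ (inl \bot%O)); last exact/inl_base/le0x.
  by rewrite topE inrE; apply/inr_base/lex1.
- by move=> le; rewrite !inrE; apply: inr_base.
Qed.

Lemma glue_le_refl d1 d2 (P : finBPOrderType d1) (Q : finTPOrderType d2) :
  reflexive (@glue_le _ _ P Q).
Proof. by move=> x; apply: connect0. Qed.

Lemma glue_le_anti d1 d2 (P : finBPOrderType d1) (Q : finTPOrderType d2) :
  antisymmetric (@glue_le _ _ P Q).
Proof.
move=> [x|y] [x'|y']; rewrite !glue_leE ?andbF //.
- by move=> /le_anti ->.
- by move=> /le_anti /val_inj ->.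
Qed.

Lemma glue_le_trans d1 d2 (P : finBPOrderType d1) (Q : finTPOrderType d2) :
  transitive (@glue_le _ _ P Q).
Proof. exact: connect_trans. Qed.

Fact glue_display (d1 d2 : Order.disp_t) : Order.disp_t.
Proof. exact: Order.Disp tt tt. Qed.

HB.instance Definition _ d1 d2 (P : finBPOrderType d1)
    (Q : finTPOrderType d2) :=
  Order.Le_isPOrder.Build (glue_display d1 d2) (glue_poset P Q)
    (@glue_le_refl _ _ P Q) (@glue_le_anti _ _ P Q) (@glue_le_trans _ _ P Q).

Lemma e_poset_max d (P : finPOrderType d) : (0 < #|P|)%N ->
  levels_free P (e_poset P) /\
  forall j, levels_free P j -> (j <= e_poset P)%N.
Proof.
move=> P0; rewrite /e_poset; apply: (@xgetPex _ 0%N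
  [set k : nat | levels_free P k /\ forall j, levels_free P j -> (j <= k)%N]).
have free0 : levels_free P 0.
  move=> n s; apply/negP => /existsP[f /and3P[_ /forallP fF _]].
  have [x _] := card_gt0P P0.
  have := fF x; rewrite inE addr0 => /andP[/le_lt_trans h /h].
  by rewrite ltxx.
have bound k : levels_free P k -> (k <= #|P|)%N.
  move=> /(_ #|P| 0) /negP Pk; rewrite leqNgt; apply/negP => ltPk; apply: Pk.
  pose f := [ffun x : P => [set enum_rank q | q : P & (q <= x)%O]].
  have memf x q : (enum_rank q \in f x) = (q <= x)%O.
    by rewrite ffunE mem_imset ?inE //; apply: enum_rank_inj.
  apply/existsP; exists f; apply/and3P; split.
  - apply/injectiveP => x y /setP fxy; apply: le_anti.
    by rewrite -memf -fxy memf lexx -memf fxy memf lexx.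
  - apply/forallP => x; rewrite inE add0r lez_nat ltz_nat leq0n /=.
    by apply: leq_ltn_trans ltPk; rewrite -[leqRHS]card_ord max_card.
  - apply/forallP => x; apply/forallP => y; apply/implyP => lexy.
    apply/fintype.subsetP => i; rewrite -(enum_valK i) !memf => /le_trans; exact.
pose B k := `[< levels_free P k >].
have exB : exists k, B k by exists 0%N; apply/asboolP.
have ubB k : B k -> (k <= #|P|)%N by move/asboolP; apply: bound.
case: (ex_maxnP exB ubB) => k /asboolP fk mk; exists k; split => // j fj.
by apply: mk; apply/asboolP.
Qed.

Lemma full_chain_level n (C : {set {set 'I_n}}) k : C \in full_chains n ->
  (k <= n)%N -> #|[set A in C | #|A| == k]| = 1%N.
Proof.
rewrite inE => /maxsetP[chC maxC] lekn.
have chP (A B : {set 'I_n}) : A \in C -> B \in C -> (A \subset B) || (B \subset A).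
  by move=> AinC BinC; move/forall_inP: chC => /(_ A AinC) /forall_inP /(_ B BinC).
have addC (A : {set 'I_n}) : (forall B : {set 'I_n}, B \in C -> (A \subset B) || (B \subset A)) -> A \in C.
  move=> cA; suff <- : A |: C = C by rewrite setU11.
  apply: maxC; last by apply: finset.subsetUr.
  apply/forall_inP => X /setU1P[->|XC]; apply/forall_inP => Y /setU1P[->|YC].
  - by rewrite subxx.
  - exact: cA.
  - by rewrite orbC; apply: cA.
  - exact: chP.
have cardP (A B : {set 'I_n}) : A \in C -> B \in C -> (#|A| <= #|B|)%N -> A \subset B.
  move=> AinC BinC leAB; case/orP: (chP _ _ AinC BinC) => // sBA.
  by rewrite (_ : A = B) ?subxx //; apply/eqP; rewrite eq_sym eqEcard sBA.
suff [A AinC cA] : exists2 A : {set 'I_n}, A \in C & #|A| = k.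
  apply/eqP/cards1P; exists A; apply/setP => B; rewrite !inE.
  apply/andP/eqP => [[BinC /eqP cB]|-> //]; last by rewrite AinC cA eqxx.
  by apply/eqP; rewrite finset.eqEsubset !cardP // cA cB.
elim: k lekn => [_|k IH ltkn].
  exists finset.set0; last by rewrite cards0.
  by apply: addC => B _; rewrite finset.sub0set.
have [A AinC cA] := IH (ltnW ltkn).
have TC : [set: 'I_n] \in C by apply: addC => B _; rewrite finset.subsetT orbT.
have hT : (fun B : {set 'I_n} => (B \in C) && (k < #|B|)%N) [set: 'I_n].
  by rewrite TC cardsT card_ord.
case: (@arg_minnP _ [set: 'I_n] (fun B : {set 'I_n} => (B \in C) && (k < #|B|)%N)
  (fun B : {set 'I_n} => #|B|) hT) => B /andP[BinC ltkB] minB.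
have sAB : A \subset B by apply: cardP; rewrite // cA ltnW.
have /fintype.subsetPn[x xB xA] : ~~ (B \subset A).
  by apply/negP => /subset_leq_card; rewrite cA leqNgt ltkB.
exists (x |: A); last by rewrite cardsU1 xA cA.
apply: addC => D DinC; case: (ltnP k #|D|) => hD.
  have sBD : B \subset D by apply: cardP => //; apply: minB; rewrite DinC.
  by rewrite finset.subUset finset.sub1set (fintype.subsetP sBD) //= (fintype.subset_trans sAB).
by rewrite [X in _ || X](fintype.subset_trans _ (finset.subsetUr _ _)) ?orbT // cardP ?cA.
Qed.

Lemma full_chains_gt0 n : (0 < #|full_chains n|)%N.
Proof.
have ch0 : is_chain (finset.set0 : {set {set 'I_n}}).
  by apply/forall_inP => A; rewrite inE.
have [C mC _] := maxset_exists ch0.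
by apply/card_gt0P; exists C; rewrite inE.
Qed.

Lemma full_chains_perm n (s : {perm 'I_n}) (C : {set {set 'I_n}}) :
  C \in full_chains n -> [set s @: A | A : {set 'I_n} in C] \in full_chains n.
Proof.
have ch (t : {perm 'I_n}) D : is_chain D -> is_chain [set t @: A | A : {set 'I_n} in D].
  move=> /forall_inP chD; apply/forall_inP => _ /imsetP[A AD ->].
  apply/forall_inP => _ /imsetP[B BD ->].
  by have /forall_inP/(_ B BD)/orP[h|h] := chD A AD; rewrite (imsetS _ h) ?orbT.
have K (t : {perm 'I_n}) : cancel (fun A : {set 'I_n} => t @: A) (fun A => (t^-1)%g @: A).
  by move=> A; rewrite -imset_comp (eq_imset _ (permK t)) imset_id.
have KK (t : {perm 'I_n}) (D : {set {set 'I_n}}) :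
    [set (t^-1)%g @: A | A : {set 'I_n} in [set t @: A | A : {set 'I_n} in D]] = D.
  by rewrite -imset_comp (eq_imset _ (K t)) imset_id.
rewrite !inE => /maxsetP[chC maxC]; apply/maxsetP; split; first exact: ch.
move=> D chD sub.
have sub' : C \subset [set (s^-1)%g @: A | A : {set 'I_n} in D].
  by rewrite -(KK s C) imsetS.
rewrite -(maxC _ (ch (s^-1)%g _ chD) sub').
by have := KK (s^-1)%g D; rewrite invgK.
Qed.

Lemma full_chains_through n (A B : {set 'I_n}) : #|A| = #|B| ->
  #|[set C in full_chains n | A \in C]| = #|[set C in full_chains n | B \in C]|.
Proof.
pose h (X : {set 'I_n}) := #|[set C in full_chains n | X \in C]|.
rewrite -/(h A) -/(h B).
have hle (s : {perm 'I_n}) (X : {set 'I_n}) : (h X <= h (s @: X))%N.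
  pose f (C : {set {set 'I_n}}) := [set s @: Y | Y : {set 'I_n} in C].
  have finj : injective f.
    by apply: imset_inj; apply: imset_inj; apply: perm_inj.
  rewrite /h -(card_imset _ finj); apply: subset_leq_card.
  apply/fintype.subsetP => _ /imsetP[C + ->]; rewrite inE => /andP[fC XC].
  by rewrite inE full_chains_perm // imset_f.
have hE (s : {perm 'I_n}) (X : {set 'I_n}) : h (s @: X) = h X.
  apply/eqP; rewrite eqn_leq hle andbT.
  apply: leq_trans (hle (s^-1)%g _) _.
  by rewrite -imset_comp (eq_imset _ (permK s)) imset_id.
move: {2}#|A :\: B| (leqnn #|A :\: B|) => m.
elim: m A => [|m IH] A.
  rewrite leqn0 cards_eq0 finset.setD_eq0 => sAB cAB.
  by congr (h _); apply/eqP; rewrite eqEcard sAB cAB leqnn.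
case: (boolP (A \subset B)) => [|nsAB].
  by move=> sAB _ cAB; congr (h _); apply/eqP; rewrite eqEcard sAB cAB leqnn.
move=> hm cAB.
have /fintype.subsetPn[x xA xB] := nsAB.
have /fintype.subsetPn[y yB yA] : ~~ (B \subset A).
  apply: contra nsAB => sBA; rewrite (_ : A = B) ?subxx //.
  by apply/eqP; rewrite eq_sym eqEcard sBA cAB leqnn.
rewrite -(hE (tperm x y)); apply: IH; last by rewrite card_imset //; apply: perm_inj.
rewrite -ltnS; apply: leq_trans hm; apply: proper_card; apply/properP; split.
  apply/fintype.subsetP => z; rewrite !inE => /andP[zB /imsetP[w wA zE]].
  move: zB; rewrite zE; case: tpermP => [wx|wy|_ _]; last by rewrite wA andbT.
    by rewrite yB.
  by move: wA; rewrite wy (negPf yA).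
exists x; rewrite !inE xB ?xA //=; apply/negP => /imsetP[w wA].
case: tpermP => [_ xy|wy|wx _ xw].
- by move: yA; rewrite -xy xA.
- by move: wA; rewrite wy (negPf yA).
- by apply: wx.
Qed.

Lemma lubellE (R : realType) n (F : {set {set 'I_n}}) :
  lubell R F = \sum_(A in F) ('C(n, #|A|))%:R^-1.
Proof.
pose N := #|full_chains n|.
pose h (X : {set 'I_n}) := #|[set C in full_chains n | X \in C]|.
have N0 : N%:R != 0 :> R by rewrite pnatr_eq0 -lt0n full_chains_gt0.
have hS (X : {set 'I_n}) : h X = (\sum_(C in full_chains n | X \in C) 1)%N.
  by rewrite /h -sum1_card; apply: eq_bigl => C; rewrite inE.
have hE (A : {set 'I_n}) : (h A * 'C(n, #|A|) = N)%N.
  have leAn : (#|A| <= n)%N by rewrite -[leqRHS]card_ord max_card.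
  transitivity (\sum_(X : {set 'I_n} | #|X| == #|A|) h X)%N.
    rewrite (eq_bigr (fun=> h A)) => [|X /eqP]; last exact: full_chains_through.
    rewrite sum_nat_const mulnC; congr (_ * _)%N.
    have := cards_draws [set: 'I_n] #|A|; rewrite cardsT card_ord => <-.
    by rewrite cardsE; apply: eq_card => X; rewrite unfold_in finset.subsetT.
  under eq_bigr do rewrite hS.
  transitivity (\sum_(C in full_chains n) \sum_(X : {set 'I_n} | (#|X| == #|A|) && (X \in C)) 1)%N.
    rewrite (exchange_big_dep (mem (full_chains n))) => [|i j _ /andP[] //] /=.
    apply: eq_bigr => C CF; apply: eq_bigl => X; by rewrite CF.
  rewrite -[RHS]sum1_card; apply: eq_bigr => C CF.
  rewrite -[RHS](full_chain_level CF leAn) -[RHS]sum1_card; apply: eq_bigl => X.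
  by rewrite inE andbC.
have sumE : (\sum_(C in full_chains n) #|F :&: C| = \sum_(A in F) h A)%N.
  transitivity (\sum_(C in full_chains n) \sum_(A in F | A \in C) 1)%N.
    by apply: eq_bigr => C _; rewrite -sum1_card; apply: eq_bigl => A; rewrite inE.
  rewrite (exchange_big_dep (mem F)) => [|i j _ /andP[] //] /=.
  by apply: eq_bigr => A AF; rewrite hS; apply: eq_bigl => C; rewrite AF.
rewrite /lubell sumE -/N natr_sum mulr_suml; apply: eq_bigr => A AF.
have := hE A; move: (h A) 'C(n, #|A|) => a b abN.
have := N0; rewrite -abN natrM mulf_eq0 negb_or => /andP[a0 b0].
by rewrite invfM mulrA divff // mul1r.
Qed.

(* Main.v *)
(** Let F be P-free, P being P1 glued on top of d(P2). The members of F that are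
the bottom of a copy of P1 in F cannot be the top of a copy of d(P2) in F, so
they form a d(P2)-free family, while the other members of F form a P1-free
family. If F only has sizes in (n/4, 3n/4), then lower-L-boundedness, applied to
complements in the first case, bounds its Lubell function by e(P1) + e(P2) + o(1),
hence |F| by (e(P1) + e(P2) + o(1)) times the central binomial coefficient; the
other sizes are exponentially rare. In a copy of P inside consecutive levels, the
element shared by P1 and d(P2) has at least e(P1) of the levels strictly above it
and at least e(P2) strictly below it, whence e(P1) + e(P2) <= e(P). Conversely,
the e(P) levels starting at the middle one form a P-free family. *)
Require Import Defs.
From HB Require Import structures.
From mathcomp Require Import all_boot all_order all_fingroup all_algebra.
From mathcomp Require Import all_classical all_reals all_analysis.
From mathcomp Require Import zify ring lra.

Set Implicit Arguments.
Unset Strict Implicit.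
Unset Printing Implicit Defensive.

Import Order.TTheory GRing.Theory Num.Theory.
Import numFieldNormedType.Exports.

Local Open Scope ring_scope.

(** * Copies of a glued poset *)

Lemma contains_posetP n (F : {set {set 'I_n}}) d (P : finPOrderType d) :
  reflect (exists f : P -> {set 'I_n}, [/\ injective f, forall x, f x \in F &
             forall x y, (x <= y)%O -> f x \subset f y])
          (contains_poset F P).
Proof.
apply: (iffP existsP) => [[f /and3P[/injectiveP fI /forallP fF fM]]|[f [fI fF fM]]].
  exists f; split=> // x y xy; move/forallP: fM => /(_ x)/forallP/(_ y).
  by rewrite xy.
exists (finfun f); apply/and3P; split.
- by apply/injectiveP => x y; rewrite !ffunE => /fI.
- by apply/forallP => x; rewrite ffunE.
- by apply/forallP => x; apply/forallP => y; apply/implyP => /fM; rewrite !ffunE.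
Qed.

Lemma contains_posetS n (F G : {set {set 'I_n}}) d (P : finPOrderType d) :
  F \subset G -> contains_poset F P -> contains_poset G P.
Proof.
move=> /fintype.subsetP FG /contains_posetP[f [fI fF fM]].
by apply/contains_posetP; exists f; split=> // x; apply: FG.
Qed.

Lemma poset_freeS n (F G : {set {set 'I_n}}) d (P : finPOrderType d) :
  F \subset G -> poset_free P G -> poset_free P F.
Proof. by move=> FG; apply: contra; apply: contains_posetS. Qed.

Definition contains_rooted n (F : {set {set 'I_n}}) d (P : finBPOrderType d)
    (A : {set 'I_n}) : Prop :=
  exists f : P -> {set 'I_n}, [/\ injective f, forall x, f x \in F,
    forall x y, (x <= y)%O -> f x \subset f y & f \bot%O = A].

Lemma contains_rooted_contains n (F : {set {set 'I_n}}) d (P : finBPOrderType d)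
  (A : {set 'I_n}) :
  contains_rooted F P A -> contains_poset [set B in F | A \subset B]%SET P.
Proof.
move=> [f [fI fF fM fA]]; apply/contains_posetP; exists f; split=> // x.
by rewrite inE fF -fA fM ?le0x.
Qed.

Definition setCs n (F : {set {set 'I_n}}) : {set {set 'I_n}} :=
  [set ~: A | A in F]%SET.

Lemma mem_setCs n (F : {set {set 'I_n}}) A : (~: A \in setCs F)%SET = (A \in F).
Proof. by rewrite mem_imset //; apply: finset.setC_inj. Qed.

Lemma mem_setCsr n (F : {set {set 'I_n}}) A : (A \in setCs F) = (~: A \in F)%SET.
Proof. by rewrite -mem_setCs finset.setCK. Qed.

(* A copy of d(P2) with top A is handled as a copy of P2 with bottom ~: A in the
   family of complements. *)
Lemma contains_glueP n (F : {set {set 'I_n}}) d1 d2 (P1 : finBPOrderType d1)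
    (P2 : finBPOrderType d2) :
  contains_poset F (glue_poset P1 P2^d) <->
  exists A : {set 'I_n},
    contains_rooted F P1 A /\ contains_rooted (setCs F) P2 (~: A)%SET.
Proof.
split=> [/contains_posetP[f [fI fF fM]]|[A [[f [fI fF fM fA]] [g [gI gF gM gA]]]]].
  exists (f (glue_inl _ \bot%O)); split.
    exists (f \o glue_inl _); split=> //= [x y /fI [] //|x y xy].
    by apply: fM; rewrite [(_ <= _)%O]glue_leE.
  (* Only the top of [P2^d] is sent to the shared point. *)
  have rI : injective (@glue_inr _ _ P1 P2^d).
    move=> x y; rewrite /glue_inr; case: insubP => [u _ <-|]; case: insubP => [v _ <-|] //.
    - by move=> [->].
    - by rewrite !negbK => /eqP -> /eqP ->.
  exists (fun y => ~: f (glue_inr P1 (y : P2^d)))%SET; split.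
  - by move=> x y /finset.setC_inj /fI /rI.
  - by move=> x; rewrite mem_setCs.
  - move=> x y xy; rewrite finset.setCS; apply: fM; rewrite [(_ <= _)%O]glue_leE.
    rewrite /glue_inr; case: insubP => [u _ uE|].
      by case: insubP => [v _ vE|//]; move: xy; rewrite -uE -vE.
    (* Here [y] is the bottom of [P2], so [x <= y] forces [x] to be the bottom too. *)
    rewrite negbK => /eqP yT; case: insubP => [v vT vE|_]; last exact: lexx.
    move: vT; case/negP; apply/eqP/le_anti; rewrite lex1 /=.
    by rewrite -yT.
  - by rewrite /glue_inr insubF //= eqxx.
(* The lower half lies strictly below [A] and the upper half contains [A], so the two halves are
   disjoint and correctly ordered. *)
have gE y : y != \bot%O -> (~: g y \proper A)%SET.
  move=> y0; rewrite finset.properEneq; apply/andP; split.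
    apply: contra y0 => /eqP h; apply/eqP/gI.
    by rewrite gA -h finset.setCK.
  by rewrite -[A]finset.setCK -gA finset.setCS gM // le0x.
have fE x : A \subset f x by rewrite -fA fM ?le0x.
apply/contains_posetP.
exists (fun u => match u with inl x => f x | inr y => ~: g (val y) end)%SET; split.
- have aux x (y : {y : P2^d | y != \top%O}) : f x <> (~: g (val y))%SET.
    move=> h; have := gE _ (valP y); rewrite -h => /proper_sub_trans/(_ (fE x)).
    by rewrite fintype.properxx.
  move=> [x|x] [y|y].
  + by move=> /fI ->.
  + by move=> /aux.
  + by move=> /esym/aux.
  + by move=> /finset.setC_inj/gI/val_inj ->.
- by move=> [x|x] //; rewrite -mem_setCsr.
- move=> [x|x] [y|y]; rewrite [(_ <= _)%O]glue_leE //.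
  + exact: fM.
  + move=> _; apply: fintype.subset_trans (fE y).
    exact: proper_sub (gE _ (valP x)).
  + by move=> h; rewrite finset.setCS; apply: gM.
Qed.

Lemma glue_free_partition n (F : {set {set 'I_n}}) d1 d2
    (P1 : finBPOrderType d1) (P2 : finBPOrderType d2) :
  poset_free (glue_poset P1 P2^d) F ->
  exists F1 : {set {set 'I_n}}, [/\ F1 \subset F,
    poset_free P2 (setCs F1) & poset_free P1 (F :\: F1)%SET].
Proof.
move=> /negP/contains_glueP Ffree.
exists [set A in F | `[< contains_rooted F P1 A >]]%SET; split.
- by apply/fintype.subsetP => A; rewrite inE => /andP[].
- apply/negP => /contains_posetP[g [gI gF gM]]; apply: Ffree.
  (* This set is in [F1], hence the bottom of a copy of [P1], and [g] supplies the copy of [d(P2)]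
     below it. *)
  exists (~: g \bot%O)%SET; split.
    by have := gF \bot%O; rewrite mem_setCsr inE => /andP[_ /asboolP].
  exists g; split=> // [x|]; last by rewrite finset.setCK.
  by have := gF x; rewrite !mem_setCsr inE => /andP[].
- apply/negP => /contains_posetP[f [fI fF fM]].
  (* The image of the bottom would itself qualify for [F1], which was removed. *)
  have := fF \bot%O; rewrite !inE negb_and => /andP[+ f0F].
  rewrite f0F => /asboolPn; apply; exists f; split=> // x.
  by have := fF x; rewrite inE => /andP[].
Qed.

(** * Consecutive levels and the glued poset *)

Lemma card_setC_int n (A : {set 'I_n}) : #|(~: A)%SET|%:Z = n%:Z - #|A|%:Z.
Proof. by have := cardsC A; rewrite card_ord; lia. Qed.

Lemma e_poset_glue_ge d1 d2 (P1 : finBPOrderType d1) (P2 : finBPOrderType d2) :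
  (e_poset P1 + e_poset P2 <= e_poset (glue_poset P1 P2^d))%N.
Proof.
have inh d (P : finBPOrderType d) : (0 < #|P|)%N.
  by apply/card_gt0P; exists \bot%O.
have [P1free _] := e_poset_max (inh _ P1).
have [P2free _] := e_poset_max (inh _ P2).
have [|_] := @e_poset_max _ (glue_poset P1 P2^d).
  by apply/card_gt0P; exists (glue_inl _ \bot%O).
apply=> n s; apply/negP => /contains_glueP[A].
(* Otherwise the copy, all of whose members contain [B], would fit into [e_poset P] levels starting
   at [#|B|]. *)
have rootP d (P : finBPOrderType d) (F : {set {set 'I_n}}) B :
    levels_free P (e_poset P) -> contains_rooted F P B ->
    exists2 C, C \in F & (#|B|%:Z + (e_poset P)%:Z <= #|C|%:Z).
  move=> /(_ n #|B|%:Z)/negP Pfree /contains_rooted_contains BP.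
  apply: contrapT => noC; apply: Pfree; apply: contains_posetS BP.
  apply/fintype.subsetP => C; rewrite !inE => /andP[CF /subset_leq_card BC].
  rewrite lez_nat BC /= ltNge; apply/negP => h; apply: noC; by exists C.
move=> [/(rootP _ _ _ _ P1free)[B1 + B1A] /(rootP _ _ _ _ P2free)[B2 + B2A]].
(* [B1] and [~: B2] differ in size by at least [e_poset P1 + e_poset P2], too much for that many
   levels. *)
rewrite mem_setCsr !inE; move: B1A B2A; rewrite !card_setC_int; lia.
Qed.

(** * Central binomial coefficient, Lubell weights and tails *)

Lemma bin_le_central n k : ('C(n, k) <= 'C(n, n./2))%N.
Proof.
have low j : (j <= n./2)%N -> ('C(n, j) <= 'C(n, n./2))%N.
  move=> /subnKC; move: (n./2 - j)%N => i; elim: i j => [|i IH] j ij.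
    by rewrite -ij addn0.
  apply: leq_trans (IH j.+1 _); last by rewrite addSnnS.
  rewrite -(@leq_pmul2l j.+1) // mul_bin_left leq_mul2r; lia.
have [/low //|kn] := leqP k n./2.
have [nk|nk] := ltnP n k; first by rewrite bin_small.
by rewrite -bin_sub //; apply: low; lia.
Qed.

Lemma central_bin_gt0 n : (0 < 'C(n, n./2))%N.
Proof. rewrite bin_gt0; lia. Qed.

Lemma exp2_le_central_bin n : (2 ^ n <= n.+1 * 'C(n, n./2))%N.
Proof.
rewrite -[2%N]/(1 + 1)%N expnDn.
under eq_bigr do rewrite !exp1n !muln1.
apply: (@leq_trans (\sum_(i < n.+1) 'C(n, n./2))).
  by apply: leq_sum => i _; apply: bin_le_central.
by rewrite sum_nat_const card_ord.
Qed.

Lemma lubell_setCs (R : realType) n (F : {set {set 'I_n}}) :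
  lubell R (setCs F) = lubell R F.
Proof.
rewrite !lubellE big_imset /=; last by move=> A B _ _; apply: finset.setC_inj.
apply: eq_bigr => A _; have := cardsC A; rewrite card_ord => An.
by rewrite -(@bin_sub n #|A|) -?[X in (X - _)%N]An ?addKn // -[leqRHS]An leq_addr.
Qed.

(** Each member has Lubell weight at least [1 / 'C(n, n./2)]. *)
Lemma card_le_lubell (R : realType) n (F : {set {set 'I_n}}) :
  #|F|%:R <= 'C(n, n./2)%:R * lubell R F.
Proof.
rewrite lubellE mulr_sumr -sum1_card natr_sum; apply: ler_sum => A _.
have An : (#|A| <= n)%N by rewrite -[leqRHS]card_ord max_card.
by rewrite ler_pdivlMr ?ltr0n ?bin_gt0 // mul1r ler_nat bin_le_central.
Qed.

(* Markov's inequality for the weights (81/16)^|A|, whose sum over all sets is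
   (97/16)^n; the bound (97/54)^n is exponentially smaller than 2^n. *)
Lemma card_large_sets (R : realType) n :
  #|[set A : {set 'I_n} | (3 * n <= 4 * #|A|)%N]%SET|%:R <= (97 / 54 : R) ^+ n.
Proof.
(* As 81/16 is the fourth power of 3/2, a set with at least 3n/4 elements has weight at least
   (3/2)^(3n). *)
have -> : 97 / 54 = (97 / 16) / (3 / 2) ^+ 3 :> R by field.
rewrite expr_div_n -exprM ler_pdivlMr; last by apply: exprn_gt0; lra.
have -> : (97 / 16 : R) ^+ n = \sum_(A : {set 'I_n}) (81 / 16) ^+ #|A|.
  have -> : 97 / 16 = 1 + 81 / 16 :> R by field.
  rewrite exprDn (partition_big (fun A : {set 'I_n} => inord #|A| : 'I_n.+1) predT) //=.
  apply: eq_bigr => i _; rewrite expr1n mul1r.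
  have iE (A : {set 'I_n}) : (inord #|A| == i :> 'I_n.+1) = (#|A| == i :> nat).
    by rewrite -val_eqE /= inordK // ltnS -[leqRHS]card_ord max_card.
  under eq_bigl do rewrite iE.
  rewrite (eq_bigr (fun=> (81 / 16) ^+ i)) => [|A /eqP -> //].
  rewrite sumr_const; congr (_ *+ _).
  have := card_draws 'I_n i; rewrite card_ord => <-.
  by apply: eq_card => A; rewrite !inE.
rewrite -sum1_card natr_sum mulr_suml big_mkcond /=; apply: ler_sum => A _.
rewrite inE; case: ifP => [An|_]; last by apply: exprn_ge0; lra.
have -> : 81 / 16 = (3 / 2) ^+ 4 :> R by field.
by rewrite mul1r -exprM ler_eXn2l //; lra.
Qed.

Lemma card_small_sets (R : realType) n :
  #|[set A : {set 'I_n} | (4 * #|A| <= n)%N]%SET|%:R <= (97 / 54 : R) ^+ n.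
Proof.
apply: le_trans (card_large_sets R n); rewrite ler_nat.
rewrite -(card_imset _ (@finset.setC_inj 'I_n)); apply: subset_leq_card.
apply/fintype.subsetP => _ /imsetP[A + ->]; rewrite !inE.
by have := cardsC A; rewrite card_ord; lia.
Qed.

(** Since 97/54 <= 2 (19/20)^2, two factors (19/20)^n are available: one absorbs the factor n+1 lost
    in comparing 2^n with the central coefficient, the other is the decay. *)
Lemma tail_ratio_le (R : realType) n :
  (97 / 54) ^+ n / 'C(n, n./2)%:R <= 19 * (19 / 20) ^+ n :> R.
Proof.
rewrite ler_pdivrMr ?ltr0n ?central_bin_gt0 //.
(* Multiplying the right side by 20/19 adds [(20 / 19) ^+ m], which is at least 1. *)
have bernoulli m : m.+1%:R <= 19 * (20 / 19) ^+ m :> R.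
  elim: m => [|m IH]; first by rewrite expr0; lra.
  have h : 1 <= (20 / 19) ^+ m :> R by apply: exprn_ege1; lra.
  by rewrite -natr1 exprS; lra.
have c2 : 2 ^+ n <= n.+1%:R * 'C(n, n./2)%:R :> R.
  by rewrite -natrX -natrM ler_nat exp2_le_central_bin.
have h1 : (97 / 54) ^+ n <= 2 ^+ n * (19 / 20) ^+ n * (19 / 20) ^+ n :> R.
  rewrite -!exprMn; apply: lerXn2r; rewrite ?nnegrE; lra.
have q0 : 0 < (19 / 20) ^+ n :> R by apply: exprn_gt0; lra.
have q1 : (20 / 19) ^+ n * (19 / 20) ^+ n = 1 :> R.
  by rewrite -exprMn; have -> : 20 / 19 * (19 / 20) = 1 :> R by [field]; rewrite expr1n.
apply: le_trans h1 _.
apply: (@le_trans _ _ (n.+1%:R * 'C(n, n./2)%:R * (19 / 20) ^+ n * (19 / 20) ^+ n)).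
  by rewrite !ler_wpM2r // ltW.
have c0 : 0 < 'C(n, n./2)%:R :> R by rewrite ltr0n central_bin_gt0.
have -> : 19 * (19 / 20) ^+ n * 'C(n, n./2)%:R =
    (19 * (20 / 19) ^+ n) * 'C(n, n./2)%:R * (19 / 20) ^+ n * (19 / 20) ^+ n :> R.
  transitivity (19 * (19 / 20) ^+ n * 'C(n, n./2)%:R *
      ((20 / 19) ^+ n * (19 / 20) ^+ n) : R).
    by rewrite q1 mulr1.
  by ring.
by rewrite !ler_wpM2r // ltW.
Qed.

(** * Levels at bounded distance from the middle *)

Lemma cvg_bin_ratio (R : realType) j :
  ((fun n : nat => 'C(n, n./2 + j)%:R / 'C(n, n./2)%:R : R) @ \oo --> (1 : R))%classic.
Proof.
elim: j => [|j IH].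
  rewrite (_ : (fun _ => _) = fun=> 1); first exact: cvg_cst.
  by apply/funext => n; rewrite addn0 divff // pnatr_eq0 -lt0n central_bin_gt0.
(* [q n] is the ratio of the binomial coefficients at [n./2 + j.+1] and [n./2 + j]. *)
pose q n : R := (n - (n./2 + j))%N%:R / (n./2 + j).+1%:R.
rewrite (_ : (fun _ => _) = fun n => 'C(n, n./2 + j)%:R / 'C(n, n./2)%:R * q n).
  rewrite -[X in (_ --> X)%classic](mulr1 1); apply: cvgM => //.
  (* The numerator of [q n] falls short of the denominator by at most 2j+2, and the denominator is
     at least (n+1)/2. *)
  apply: (@squeeze_cvgr _ _ _ _ (fun n => 1 - (4 * j + 4)%N%:R * harmonic n) (fun=> 1)).
  - near=> n; rewrite /q; apply/andP; split; last first.
      by rewrite ler_pdivrMr ?ltr0n // mul1r ler_nat; lia.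
    rewrite ler_pdivlMr ?ltr0n // mulrBl mul1r lerBlDr.
    apply: (@le_trans _ _ ((n - (n./2 + j))%N%:R + (2 * j + 2)%N%:R)).
      by rewrite -natrD ler_nat; lia.
    rewrite lerD2l /harmonic /= mulrAC ler_pdivlMr ?ltr0n //.
    by rewrite -!natrM ler_nat; nia.
  - rewrite -[X in (_ --> X)%classic](subr0 1) -(mulr0 (4 * j + 4)%N%:R).
    by apply: cvgB; [exact: cvg_cst | apply: cvgMr; exact: cvg_harmonic].
  - exact: cvg_cst.
apply/funext => n; rewrite mulrAC; congr (_ / _).
by rewrite /q mulrA -natrM addnS mulnC -mul_bin_left natrM mulrAC divff ?mul1r.
Unshelve. all: by end_near. Qed.

Lemma card_levels n m k :
  #|levels n m%:Z k| = (\sum_(j < k) 'C(n, m + j))%N.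
Proof.
elim: k => [|k IH].
  by rewrite big_ord0; apply: eq_card0 => A; rewrite !inE; lia.
rewrite big_ord_recr -IH /= -(cardsID (levels n m k)); congr (_ + _)%N.
  by apply: eq_card => A; rewrite !inE; lia.
have := card_draws 'I_n (m + k); rewrite card_ord => <-.
by apply: eq_card => A; rewrite !inE; lia.
Qed.

Lemma sum_bin_le_La n d (P : finPOrderType d) : (0 < #|P|)%N ->
  (\sum_(j < e_poset P) 'C(n, n./2 + j) <= La n P)%N.
Proof.
move=> P0; rewrite -card_levels.
apply: (@leq_bigmax_cond _ (poset_free P (n := n)) (fun G => #|G|)).
exact: (e_poset_max P0).1.
Qed.

(** * Upper bound and limit *)

Lemma card_glue_free_le (R : realType) d1 d2 (P1 : finBPOrderType d1)
    (P2 : finBPOrderType d2) (eps : R) :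
  lower_L_bounded R P1 -> lower_L_bounded R P2 -> 0 < eps ->
  exists N, forall n, (N <= n)%N -> forall F : {set {set 'I_n}},
  poset_free (glue_poset P1 P2^d) F ->
  #|F|%:R <= 'C(n, n./2)%:R * ((e_poset P1 + e_poset P2)%:R + eps * 2) +
             2 * (97 / 54) ^+ n.
Proof.
move=> L1 L2 eps0.
(* With sizes strictly between n/4 and 3n/4, both the sets and their complements stay below 3n/4. *)
have beta : 2^-1 < (3 / 4 : R) < 1 by apply/andP; split; lra.
have [N1 {}L1] := L1 _ _ beta eps0; have [N2 {}L2] := L2 _ _ beta eps0.
exists (N1 + N2)%N => n nN F Ffree.
pose small := [set A : {set 'I_n} | (4 * #|A| <= n)%N]%SET.
pose large := [set A : {set 'I_n} | (3 * n <= 4 * #|A|)%N]%SET.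
pose M := (F :\: (small :|: large))%SET.
have Mfree : poset_free (glue_poset P1 P2^d) M.
  by apply: poset_freeS Ffree; apply: finset.subsetDl.
have [F1 [F1M F1free F2free]] := glue_free_partition Mfree.
have sizeM (A : {set 'I_n}) : A \in M -> (n < 4 * #|A| < 3 * n)%N.
  by rewrite !inE; lia.
have lt_beta k : (4 * k < 3 * n)%N -> k%:R < 3 / 4 * n%:R :> R.
  by rewrite -(ltr_nat R) !natrM; lra.
have h1 : #|F1|%:R <= 'C(n, n./2)%:R * ((e_poset P2)%:R + eps) :> R.
  apply: le_trans (card_le_lubell R F1) _; rewrite ler_wpM2l ?ler0n //.
  rewrite -lubell_setCs; apply: L2 F1free _; first by lia.
  move=> A; rewrite mem_setCsr => /(fintype.subsetP F1M)/sizeM.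
  by move=> h; apply: lt_beta; have := cardsC A; rewrite card_ord; lia.
have h2 : #|M :\: F1|%SET%:R <= 'C(n, n./2)%:R * ((e_poset P1)%:R + eps) :> R.
  apply: le_trans (card_le_lubell R _) _; rewrite ler_wpM2l ?ler0n //.
  apply: L1 F2free _; first by lia.
  by move=> A /finset.setDP[/sizeM h _]; apply: lt_beta; lia.
have hF : (#|F| <= #|small| + #|large| + (#|F1| + #|M :\: F1|%SET))%N.
  have -> : (#|F1| + #|M :\: F1|%SET = #|M|)%N.
    by rewrite -(cardsID F1 M) (finset.setIidPr F1M).
  rewrite -(cardsID (small :|: large)%SET F) leq_add2r.
  apply: leq_trans (leq_card_setU _ _).
  exact/subset_leq_card/finset.subsetIr.
have := card_small_sets R n; have := card_large_sets R n.
move: hF; rewrite -(ler_nat R) !natrD -/small -/large; lra.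
Qed.

Local Open Scope classical_set_scope.

Theorem theorem7p3 (R : realType) (d1 d2 : Order.disp_t)
    (P1 : finBPOrderType d1) (P2 : finBPOrderType d2) :
  lower_L_bounded R P1 -> lower_L_bounded R P2 ->
  (fun n : nat => (La n (glue_poset P1 P2^d))%:R / ('C(n, n./2))%:R : R) @ \oo
    --> ((e_poset (glue_poset P1 P2^d))%:R : R).
Proof.
move=> L1 L2; set P := glue_poset P1 P2^d; set e := e_poset P.
have P0 : (0 < #|{: P}|)%N by apply/card_gt0P; exists (glue_inl _ \bot%O).
have lower : (fun n => \sum_(j < e) ('C(n, n./2 + j)%:R / 'C(n, n./2)%:R : R)) @ \oo
    --> (e%:R : R).
  rewrite -[e in e%:R]card_ord -sumr_const.
  by apply: cvg_big => [|j _]; [apply: add_continuous|apply: cvg_bin_ratio].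
(* 38 is twice the constant 19 of [tail_ratio_le], for the small and the large sets. *)
have tail : (fun n => 38 * (19 / 20) ^+ n : R) @ \oo --> (0 : R).
  by apply: cvg_geometric; rewrite ger0_norm; lra.
apply/cvgrPdist_le => eps eps0.
(* Two quarters go to the two Lubell bounds and one to the tails. *)
have eps4 : 0 < eps / 4 by lra.
have [N upper] := card_glue_free_le L1 L2 eps4.
near=> n.
have c0 : 0 < 'C(n, n./2)%:R :> R by rewrite ltr0n central_bin_gt0.
have lo : e%:R - eps <= (La n P)%:R / 'C(n, n./2)%:R.
  apply: (@le_trans _ _ (\sum_(j < e) ('C(n, n./2 + j)%:R / 'C(n, n./2)%:R))).
    rewrite lerBlDl -lerBlDr; apply: le_trans (ler_norm _) _.
    by near: n; apply: (cvgrPdist_le _ _).1.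
  by rewrite -mulr_suml ler_wpM2r ?invr_ge0 ?ler0n // -natr_sum ler_nat sum_bin_le_La.
have hi : (La n P)%:R / 'C(n, n./2)%:R <= e%:R + eps.
  have tn : 38 * (19 / 20) ^+ n <= eps / 4.
    rewrite -[leLHS]subr0; apply: le_trans (ler_norm _) _; rewrite distrC.
    by near: n; apply: (cvgrPdist_le _ _).1.
  have Lan : (La n P)%:R <= 'C(n, n./2)%:R * (e%:R + eps / 4 * 2) + 2 * (97 / 54) ^+ n :> R.
    (* [La] is a [\max] with default 0, so the bound is also checked at 0. *)
    apply: (big_ind (fun m : nat => m%:R <= _)).
    - by rewrite addr_ge0 ?mulr_ge0 ?addr_ge0 ?exprn_ge0 ?ler0n //; lra.
    - by move=> x y hx hy; rewrite /maxn; case: ifP.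
    - move=> F Ffree; apply: le_trans (upper n _ F Ffree) _; first by near: n; exists N.
      by rewrite lerD2r ler_wpM2l ?ler0n // lerD2r ler_nat e_poset_glue_ge.
  apply: le_trans (_ : e%:R + eps / 4 * 2 + 2 * (19 * (19 / 20) ^+ n) <= _); last by lra.
  have := tail_ratio_le R n; rewrite ler_pdivrMr // => tl.
  rewrite ler_pdivrMr // mulrDl; apply: le_trans Lan _.
  by rewrite mulrC lerD2l -mulrA ler_wpM2l.
rewrite ler_distlC; lra.
Unshelve. all: by end_near. Qed.
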